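(* Let $\mathcal{M}$ be a Hilbert manifold. Let $\|\cdot\|_X$ be a norm on the tangent bundle $\mathcal{T}\mathcal{M}$ and let $\|\cdot\|_Y$ be a norm on the ambient space of $\mathcal{M}$ which is complete ($\|\cdot\|_X$ and $\|\cdot\|_Y$ may be the same or different). Let $E$ be a differentiable real-valued function on $\mathcal{M}$ with manifold gradient $\mathrm{grad}\,E(u)$, and let $\{u_n\}_{n=0}^\infty\subset\mathcal{M}$ be a sequence generated by some iterative algorithm. Assume that the following three conditions hold. (L) (Łojasiewicz gradient inequality) There exist a cluster point $u^*$ of $\{u_n\}$ and constants $0<C_L<+\infty$, $0<\theta\le\frac12$ such that for all large enough $n$, $$|E(u_n)-E(u^* )|^{1-\theta}\le C_L\|\mathrm{grad}\,E(u_n)\|_X.$$ (D) (Descent inequality) There exists $C_D>0$ such that for all large enough $n$, $$E(u_n)-E(u_{n+1})\ge C_D\|\mathrm{grad}\,E(u_n)\|_X\,\|u_{n+1}-u_n\|_Y.$$ (S) (Step-size condition) There exists $C_S>0$ such that for all large enough $n$, $$\|u_{n+1}-u_n\|_Y\ge C_S\|\mathrm{grad}\,E(u_n)\|_X.$$ Then $u^*$ is the unique limit point of $\{u_n\}_{n=0}^\infty$ with respect to $\|\cdot\|_Y$. Moreover, $\{u_n\}$ converges to $u^*$ with the asymptotic convergence rate $$\|u_n-u^*\|_Y\lesssim\begin{cases}e^{cn}, & \theta=\frac12,\\ n^{-\frac{\theta}{1-2\theta}}, & \theta\in(0,\frac12),\end{cases}$$ where $c:=\log\left(1-\frac{C_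DC_S}{2C_L^2}\right)$.
   Context: $\mathcal{M}$ is a submanifold of an ambient vector space, so that differences $u_{n+1}-u_n$ of points of $\mathcal{M}$ make sense in the ambient space. The quantity $\|\mathrm{grad}\,E(u_n)\|_X$ is the $X$-norm of the tangent vector $\mathrm{grad}\,E(u_n)\in\mathcal{T}_{u_n}\mathcal{M}$; the norm $\|\cdot\|_X$ may vary with the base point. The manifold gradient $\mathrm{grad}\,E(u)$ is the gradient of $E$ on $\mathcal{M}$ at $u$ with respect to the inner product on the tangent space. The notation $a_n\lesssim b_n$ means that there is a constant $K>0$ independent of $n$ with $a_n\le K b_n$ for all large enough $n$.
   Formalization: The formal theorem also assumes that for all large n, grad E(u_n)=0 implies u_{n+1}=u_n; otherwise E=0, u_n=(-1)^n is a counterexample. If 1-C_D C_S/(2C_L^2) is not positive, so that the log is undefined, c is read as 0. *)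

(* Defs.v *)
From HB Require Import structures.
From mathcomp Require Import all_boot all_order all_algebra.
From mathcomp Require Import all_classical all_reals all_analysis.

Set Implicit Arguments.
Unset Strict Implicit.
Unset Printing Implicit Defensive.

Import Order.TTheory GRing.Theory Num.Theory.
Import numFieldNormedType.Exports.
Local Open Scope classical_set_scope.
Local Open Scope ring_scope.

(* Smoothness is defined by iterating the tangent map
   (x, v) |-> Df(x) v, where Df(x) is the Frechet derivative. For a fixed k this
   asks for joint continuity of (x, v) |-> Df(x) v, which is slightly less than
   continuity of x |-> Df(x) in operator norm, but being k-times differentiable
   in this sense for all k is the usual C^oo condition on an open set U. *)
Fixpoint Ck_on (R : realType) (k : nat) :
    forall V W : normedModType R, set V -> (V -> W) -> Prop :=
  match k with
  | 0%N => fun V W U f => forall x, U x -> {for x, continuous f}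
  | k'.+1 => fun V W U f =>
      (forall x, U x -> differentiable f x) /\
      Ck_on k' (V := (V * V)%type) (U `*` setT) (fun p => 'd f (p.1) p.2)
  end.

Definition smooth_on (R : realType) (V W : normedModType R) (U : set V)
  (f : V -> W) : Prop := forall k : nat, Ck_on k U f.

Definition inner_product_on (R : realType) (V : lmodType R) (S : set V)
    (g : V -> V -> R) : Prop :=
  [/\ forall v w, S v -> S w -> g v w = g w v,
      forall a v w z, S v -> S w -> S z -> g (a *: v + w) z = a * g v z + g w z
    & forall v, S v -> v != 0 -> 0 < g v v].

Definition norm_on (R : realType) (V : lmodType R) (S : set V)
    (N : V -> R) : Prop :=
  [/\ forall v w, S v -> S w -> N (v + w) <= N v + N w,
      forall a v, S v -> N (a *: v) = `|a| * N v
    & forall v, S v -> N v = 0 -> v = 0].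

(* Completeness is part of the type of H. *)
Definition hilbert_space (R : realType) (H : completeNormedModType R) : Prop :=
  exists2 g : H -> H -> R, inner_product_on setT g &
    forall x, `|x| ^+ 2 = g x x.

(* A smooth manifold modelled on H and lying in the normed space V. The atlas is
   given by the inverses hm_par i : hm_dom i -> V of the charts. The topology and
   the smooth structure are those of the atlas, and the inclusion in V is a
   smooth map with injective differential. Submanifolds of V in the embedded
   sense are included; for these the topology of the atlas is that of V. *)
Record hilbert_submanifold (R : realType) (H V : completeNormedModType R) :=
  HilbertSubmanifold {
    hm_set : set V;
    hm_index : Type;
    hm_dom : hm_index -> set H;
    hm_par : hm_index -> H -> V;
    hm_dom_open : forall i, open (hm_dom i);
    hm_cover : hm_set = \bigcup_i (hm_par i @` hm_dom i);
    hm_inj : forall i, set_inj (hm_dom i) (hm_par i);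
    hm_smooth : forall i, smooth_on (hm_dom i) (hm_par i);
    hm_immersion : forall i x, hm_dom i x -> injective ('d (hm_par i) x);
    hm_overlap_open : forall i j,
      open (hm_dom i `&` hm_par i @^-1` (hm_par j @` hm_dom j));
    hm_transition : forall i j, exists2 t : H -> H,
      smooth_on (hm_dom i `&` hm_par i @^-1` (hm_par j @` hm_dom j)) t &
      forall x, (hm_dom i `&` hm_par i @^-1` (hm_par j @` hm_dom j)) x ->
        hm_dom j (t x) /\ hm_par j (t x) = hm_par i x
  }.

Section Manifold.
Variables (R : realType) (H V : completeNormedModType R).
Variable M : hilbert_submanifold H V.

(* Neighbourhoods for the manifold topology, as subsets of V of which only the
   trace on M matters. *)
Definition manifold_nbhs (p : V) : set_system V :=
  [set A | exists (i : hm_index M) x,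
     [/\ hm_dom i x, hm_par i x = p & nbhs x (hm_par i @^-1` A)]].

Definition manifold_cluster_point (u : nat -> V) (p : V) : Prop :=
  hm_set M p /\ (u @ \oo) `#` manifold_nbhs p.

Definition tangent (p : V) : set V :=
  [set v | exists (i : hm_index M) x h,
     [/\ hm_dom i x, hm_par i x = p & v = 'd (hm_par i) x h]].

Definition manifold_differentiable (E : V -> R) : Prop :=
  forall (i : hm_index M) x, hm_dom i x ->
    differentiable (E \o hm_par i : H -> R^o) x.

Definition is_manifold_gradient (g : V -> V -> V -> R) (E : V -> R)
    (grad : V -> V) : Prop :=
  (forall p, hm_set M p -> tangent p (grad p)) /\
  forall (i : hm_index M) x h, hm_dom i x ->
    let p := hm_par i x in
    g p (grad p) ('d (hm_par i) x h)
    = 'd (E \o hm_par i : H -> R^o) x h.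

End Manifold.

(* Main.v *)
(* Write r_n = E(u_n) - E(ustar) and d_n = |u_(n+1) - u_n|. Continuity of E along
   the charts and descent give r_n >= 0 eventually. Dividing the descent
   inequality by the gradient norm with the help of the Lojasiewicz inequality,
   concavity of r |-> r^theta yields d_n <= C (r_n^theta - r_(n+1)^theta), which
   telescopes: since ustar is a cluster point, |u_n - ustar| <= C r_n^theta. Together
   with the step-size condition, descent also gives
   r_(n+1) <= r_n - q r_n^(2 - 2 theta) with q = C_D C_S / C_L^2. For
   theta = 1/2 the decay of r_n^(1/2) is geometric, because
   1 - q <= (1 - q/2)^2; for theta < 1/2 the quantity r_n^(2 theta - 1) grows at
   least linearly. *)
Require Import Defs.
From HB Require Import structures.
From mathcomp Require Import all_boot all_order all_algebra.
From mathcomp Require Import all_classical all_reals all_analysis.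
From mathcomp Require Import ring lra.
Import Order.TTheory GRing.Theory Num.Theory.
Import numFieldNormedType.Exports.
Local Open Scope classical_set_scope.
Local Open Scope ring_scope.

Set Implicit Arguments.
Unset Strict Implicit.
Unset Printing Implicit Defensive.

(** Young's inequality for [r]^ (1 - t)[and]s [^ t] with the conjugate exponents [(1 - t)^-1] and
    [t^-1]. *)
Lemma powR_weighted_AGM (R : realType) (r s t : R) :
  0 <= r -> 0 <= s -> 0 < t -> t < 1 ->
  r `^ (1 - t) * s `^ t <= (1 - t) * r + t * s.
Proof.
move=> r0 s0 t0 t1; have t10 : 0 < 1 - t by lra.
have := @conjugate_powR R (r `^ (1 - t)) (s `^ t) (1 - t)^-1 t^-1
  (powR_ge0 _ _) (powR_ge0 _ _).
rewrite !invr_gt0 !invrK => /(_ t10 t0 (subrK _ _)).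
by rewrite -!powRrM !divff ?gt_eqF// !powRr1// (mulrC r) (mulrC s).
Qed.

(** Bernoulli's inequality for the exponent [- p], multiplied out. It follows from
    [ln (1 - x) <= - x] and [1 + p * x <= expR (p * x)]. *)
Lemma powR_1B_bernoulli (R : realType) (p x : R) :
  0 <= p -> x < 1 -> (1 - x) `^ p * (1 + p * x) <= 1.
Proof.
move=> p0 x1; have y0 : 0 < 1 - x by lra.
have -> : (1 - x) `^ p = expR (p * ln (1 - x)) by rewrite /powR gt_eqF.
have lnle : p * ln (1 - x) <= - (p * x).
  by rewrite -mulrN ler_wpM2l// le_ln1Dx//; lra.
apply: (@le_trans _ _ (expR (p * ln (1 - x)) * expR (p * x))).
  by rewrite ler_pM2l ?expR_gt0// expR_ge1Dx.
by rewrite -expRD -[leRHS]expR0 ler_expR; lra.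
Qed.

Lemma powR_recursion_decay (R : realType) (p a : R) (r : nat -> R) (N : nat) :
  0 < p -> 0 < a -> (forall n, (N <= n)%N -> 0 <= r n) ->
  (forall n, (N <= n)%N -> r n.+1 <= r n - a * r n `^ (1 + p)) ->
  exists2 K, 0 < K & \forall n \near \oo, r n `^ p <= K * n%:R^-1.
Proof.
move=> p0 a0 r_ge0 r_rec.
have inv k : p * a * k%:R * r (N + k)%N `^ p <= 1.
  elim: k => [|k IH]; first by rewrite mulr0 mul0r ler01.
  have Nk : (N <= N + k)%N by rewrite leq_addr.
  have := r_rec _ Nk; have := r_ge0 _ Nk; have := r_ge0 _ (leqW Nk).
  rewrite -addnS in r_rec *; move: (r (N + k)%N) (r (N + k.+1)%N) IH => x y IH.
  (* The case [y = 0] is trivial; [0 < y] forces [0 < x] and [z < 1], as Bernoulli requires. *)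
  rewrite le_eqVlt => /predU1P[<- _ _|y0 x0].
    by rewrite powR0 ?gt_eqF// mulr0 ler01.
  rewrite powRD ?powRr1//; last by rewrite gt_eqF//; lra.
  set z := a * x `^ p => le_y.
  have yz : y <= x * (1 - z) by rewrite /z; lra.
  have xz0 : 0 < x * (1 - z) by apply: lt_le_trans yz.
  have xgt0 : 0 < x by rewrite lt_neqAle x0 andbT; apply: contraL xz0 => /eqP <-;
    rewrite mul0r ltxx.
  have z1 : 0 < 1 - z by rewrite -(pmulr_rgt0 _ xgt0).
  have -> : p * a * k.+1%:R = p * a * k%:R + p * a by rewrite -natr1; ring.
  have yp : y `^ p <= x `^ p * (1 - z) `^ p.
    rewrite -powRM//; last exact: ltW.
    by apply: ge0_ler_powR => //; rewrite ?nnegrE ltW.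
  apply: (le_trans (ler_wpM2l _ yp)).
    by rewrite addr_ge0// !mulr_ge0// ltW.
  apply: le_trans (powR_1B_bernoulli (ltW p0) (_ : z < 1)); last by lra.
  rewrite mulrA [leRHS]mulrC ler_wpM2r ?powR_ge0//.
  by rewrite mulrDl -(mulrA p a (x `^ p)) -/z lerD2r.
(* The factor 2 pays for [n / 2 <= n - N], valid once [2 * N <= n]; [1 <= n] allows the division by
   [n]. *)
exists (2 / (p * a)); first by rewrite divr_gt0// mulr_gt0.
exists (maxn 1 N.*2) => // n; rewrite /= geq_max => /andP[n1 nN].
have Nn : (N <= n)%N by apply: leq_trans nN; rewrite -addnn leq_addr.
have := inv (n - N)%N; rewrite subnKC//.
have le_n : (n%:R / 2 : R) <= (n - N)%N%:R.
  rewrite natrB//; move: nN; rewrite -(@ler_nat R) -addnn natrD.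
  by lra.
move=> h; rewrite ler_pdivlMr ?ltr0n// ler_pdivlMr ?mulr_gt0//.
have := ler_wpM2l (_ : 0 <= p * a * r n `^ p) le_n.
rewrite !mulr_ge0 ?powR_ge0 ?(ltW p0) ?(ltW a0)// => /(_ isT).
by lra.
Qed.

(* As t <= 1, the increments of the t-th powers of the energy gap dominate the
   steps: t * r `^ (t - 1) * (r - s) <= r `^ t - s `^ t by concavity. *)
Lemma lojasiewicz_step (R : realType) (CL CD t G d r s : R) :
  0 < CL -> 0 < CD -> 0 < t -> t < 1 -> 0 <= r -> 0 <= s -> 0 <= d ->
  r `^ (1 - t) <= CL * G -> CD * G * d <= r - s -> (G = 0 -> d = 0) ->
  d <= CL / (CD * t) * (r `^ t - s `^ t).
Proof.
move=> CL0 CD0 t0 t1 r0 s0 d0 hL hD hG.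
have G_ge0 : 0 <= G by rewrite -(pmulr_rge0 _ CL0) (le_trans _ hL) ?powR_ge0.
have sr : s <= r by have := mulr_ge0 (mulr_ge0 (ltW CD0) G_ge0) d0; lra.
have st : s `^ t <= r `^ t by apply: ge0_ler_powR; rewrite ?nnegrE// ltW.
move: G_ge0; rewrite le_eqVlt => /predU1P[/esym/hG ->|G0].
  by rewrite mulr_ge0 ?subr_ge0// divr_ge0 ?mulr_ge0// ltW.
have agm := powR_weighted_AGM r0 s0 t0 t1.
have rr : r `^ (1 - t) * r `^ t = r.
  by rewrite -powRD subrK ?powRr1// oner_eq0.
have h1 := ler_wpM2r (_ : 0 <= r `^ t - s `^ t) hL.
move: h1; rewrite subr_ge0 st => /(_ isT) h1.
have h2 := ler_wpM2l (ltW t0) hD.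
rewrite mulrAC ler_pdivlMr ?mulr_gt0// -(ler_pM2l G0).
rewrite mulrBr rr in h1; lra.
Qed.

Lemma telescope_dist (R : realType) (V : normedModType R) (u : nat -> V)
    (f : nat -> R) (N m n : nat) :
  (forall k, (N <= k)%N -> `|u k.+1 - u k| <= f k - f k.+1) ->
  (N <= n)%N -> (n <= m)%N -> `|u m - u n| <= f n - f m.
Proof.
move=> uf Nn; elim: m => [|m IH].
  by rewrite leqn0 => /eqP ->; rewrite !subrr normr0.
rewrite leq_eqVlt => /predU1P[->|]; first by rewrite !subrr normr0.
rewrite ltnS => nm; have := uf m (leq_trans Nn nm); have := IH nm.
have := ler_normD (u m.+1 - u m) (u m - u n).
by rewrite addrA subrK; lra.
Qed.

(** Both the chart and [E] read in the chart are continuous, so closeness to [p] in norm and in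
    energy defines a manifold neighbourhood, which every tail of [u] meets. *)
Lemma manifold_cluster_frequently (R : realType) (H V : completeNormedModType R)
    (M : hilbert_submanifold H V) (E : V -> R) (u : nat -> V) (p : V) :
  manifold_differentiable M E -> manifold_cluster_point M u p ->
  forall (e : R) (N : nat), 0 < e -> exists n,
    [/\ (N <= n)%N, `|u n - p| < e & `|E (u n) - E p| < e].
Proof.
move=> hE [Mp clu] e N e0.
move: (Mp); rewrite hm_cover => -[i _ [x dx xp]].
have par_cvg : hm_par i y @[y --> x] --> hm_par i x by apply: (hm_smooth i 0%N).
have Epar_cvg : E (hm_par i y) @[y --> x] --> E (hm_par i x) :=
  differentiable_continuous (hE _ _ dx).
have [] := clu [set v | exists2 n, (N <= n)%N & u n = v]
  [set v | `|v - p| < e /\ `|E v - E p| < e].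
- by exists N => // n /= Nn; exists n.
- exists i, x; split => //.
  have h1 : \forall y \near x, `|hm_par i y - p| < e.
    by rewrite -xp; exact: cvgr_distC_lt.
  have h2 : \forall y \near x, `|E (hm_par i y) - E p| < e.
    by rewrite -xp; exact: cvgr_distC_lt.
  by near=> y; split; near: y.
- by move=> _ [[n Nn <-] [h1 h2]]; exists n.
Unshelve. all: by end_near. Qed.

Theorem theorem2p1 (R : realType)
  (H : completeNormedModType R) (hH : hilbert_space H)
  (* the norm of V is the Y-norm *)
  (V : completeNormedModType R)
  (M : hilbert_submanifold H V)
  (g : V -> V -> V -> R)
  (hg : forall p, hm_set M p -> inner_product_on (tangent M p) (g p))
  (normX : V -> V -> R)
  (hX : forall p, hm_set M p -> norm_on (tangent M p) (normX p))
  (E : V -> R) (hE : manifold_differentiable M E)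
  (grad : V -> V) (hgrad : is_manifold_gradient M g E grad)
  (u : nat -> V) (hu : forall n, hm_set M (u n))
  (* the algorithm rests at critical points *)
  (hstop : \forall n \near \oo, grad (u n) = 0 -> u n.+1 = u n)
  (ustar : V) (CL theta CD CS : R)
  (hustar : manifold_cluster_point M u ustar)
  (hCL : 0 < CL) (htheta0 : 0 < theta) (htheta : theta <= 2^-1)
  (hL : \forall n \near \oo,
     `|E (u n) - E ustar| `^ (1 - theta) <= CL * normX (u n) (grad (u n)))
  (hCD : 0 < CD)
  (hD : \forall n \near \oo,
     CD * normX (u n) (grad (u n)) * `|u n.+1 - u n| <= E (u n) - E (u n.+1))
  (hCS : 0 < CS)
  (hS : \forall n \near \oo,
     CS * normX (u n) (grad (u n)) <= `|u n.+1 - u n|) :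
  let c := ln (1 - CD * CS / (2 * CL ^+ 2)) in
  [/\ cluster (u @ \oo) = [set ustar],
      u @ \oo --> ustar,
      theta = 2^-1 ->
        exists2 K : R, 0 < K &
          \forall n \near \oo, `|u n - ustar| <= K * expR (c * n%:R)
    & theta < 2^-1 ->
        exists2 K : R, 0 < K &
          \forall n \near \oo,
            `|u n - ustar| <= K * n%:R `^ (- (theta / (1 - 2 * theta)))].
Proof.
move=> c.
have [N _ HN] : \forall n \near \oo,
  [/\ `|E (u n) - E ustar| `^ (1 - theta) <= CL * normX (u n) (grad (u n)),
    CD * normX (u n) (grad (u n)) * `|u n.+1 - u n| <= E (u n) - E (u n.+1),
    CS * normX (u n) (grad (u n)) <= `|u n.+1 - u n|
  & grad (u n) = 0 -> u n.+1 = u n].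
  by near=> n; split; near: n.
pose r n := E (u n) - E ustar.
pose G n := normX (u n) (grad (u n)).
have G_ge0 n : (N <= n)%N -> 0 <= G n.
  by move=> /HN[h _ _ _]; rewrite -(pmulr_rge0 _ hCL) (le_trans _ h) ?powR_ge0.
have r_succ n : (N <= n)%N -> CD * G n * `|u n.+1 - u n| <= r n - r n.+1.
  by move=> /HN[_ h _ _]; rewrite /r opprB addrA subrK.
have r_mono n m : (N <= n)%N -> (n <= m)%N -> r m <= r n.
  move=> Nn; elim: m => [|m IH]; first by rewrite leqn0 => /eqP ->.
  rewrite leq_eqVlt => /predU1P[->//|]; rewrite ltnS => nm.
  have Nm := leq_trans Nn nm; apply: le_trans (IH nm).
  rewrite -subr_ge0; apply: le_trans (r_succ _ Nm).
  by rewrite mulr_ge0// mulr_ge0 ?G_ge0// ltW.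
have freq := manifold_cluster_frequently hE hustar.
(* A negative gap could only decrease further, which would keep the energies away from [E ustar]. *)
have r_ge0 n : (N <= n)%N -> 0 <= r n.
  move=> Nn; rewrite leNgt; apply/negP => rn0.
  have [|m [nm _]] := freq (- r n) n; first by rewrite oppr_gt0.
  by have := r_mono _ _ Nn nm; rewrite -/(r m); have := ler_norm (- r m);
    rewrite normrN; lra.
have theta1 : theta < 1 by lra.
have r_norm n : (N <= n)%N -> `|E (u n) - E ustar| = r n.
  by move=> /r_ge0/ger0_norm.
pose C := CL / (CD * theta).
have C0 : 0 < C by rewrite divr_gt0// mulr_gt0.
have step n : (N <= n)%N ->
    `|u n.+1 - u n| <= C * r n `^ theta - C * r n.+1 `^ theta.
  move=> Nn; have [hL' _ _ hstop'] := HN _ Nn; rewrite -mulrBr.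
  apply: (lojasiewicz_step (G := G n)); rewrite ?r_ge0 ?(leqW Nn)//.
  - by rewrite -(r_norm n Nn).
  - exact: r_succ.
  (* A vanishing gradient norm means a vanishing gradient, where the algorithm rests. *)
  - have [_ _ X0] := hX _ (hu n).
    by move=> /(X0 _ (hgrad.1 _ (hu n)))/hstop' ->; rewrite subrr normr0.
have dist n : (N <= n)%N -> `|u n - ustar| <= C * r n `^ theta.
  move=> Nn; apply/ler_addgt0Pr => e e0.
  (* Telescoping up to one late iterate near [ustar] suffices: convergence is not yet known, and the
     term in [r m] is dropped by its sign. *)
  have [m [nm me _]] := freq e n e0.
  have := telescope_dist step Nn nm; have := powR_ge0 (r m) theta.
  move=> /(mulr_ge0 (ltW C0)); rewrite distrC.
  by have := ler_normD (u n - u m) (u m - ustar); rewrite addrA subrK; lra.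
have u_cvg : u @ \oo --> ustar.
  apply/cvgrPdist_le => e e0.
  have e'0 : 0 < (e / C) `^ theta^-1 by rewrite powR_gt0// divr_gt0.
  have [n [Nn _ rn]] := freq _ N e'0.
  rewrite r_norm// in rn.
  exists n => // m /= nm; rewrite distrC.
  apply: (le_trans (dist m (leq_trans Nn nm))).
  rewrite mulrC -ler_pdivlMr//.
  have -> : e / C = ((e / C) `^ theta^-1) `^ theta.
    by rewrite -powRrM mulVf ?gt_eqF// powRr1// divr_ge0 ?ltW.
  apply: ge0_ler_powR; rewrite ?nnegrE ?r_ge0 ?(leq_trans Nn nm)// ?ltW//.
  exact: le_lt_trans (r_mono _ _ Nn nm) rn.
have r_decay n : (N <= n)%N ->
    r n.+1 <= r n - CD * CS / CL ^+ 2 * r n `^ (1 + (1 - 2 * theta)).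
  move=> Nn; have [hL' _ hS' _] := HN _ Nn; have rs := r_succ _ Nn.
  rewrite r_norm// -/(G n) in hL'; rewrite -/(G n) in hS'.
  have G0 := G_ge0 _ Nn.
  (* The exponent is stated as [1 + p] for the decay lemma; here it shows the square of the
     Lojasiewicz inequality. *)
  have -> : 1 + (1 - 2 * theta) = (1 - theta) * 2%:R by ring.
  rewrite powRrM powR_mulrn ?powR_ge0//.
  have sq : (r n `^ (1 - theta)) ^+ 2 <= CL ^+ 2 * G n ^+ 2.
    by rewrite -exprMn lerXn2r ?nnegrE ?powR_ge0// mulr_ge0// ltW.
  have q : CD * CS / CL ^+ 2 * (r n `^ (1 - theta)) ^+ 2 <= CD * CS * G n ^+ 2.
    rewrite mulrAC ler_pdivrMr ?exprn_gt0// -!(mulrA (CD * CS)) ler_pM2l ?mulr_gt0//.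
    by rewrite [leRHS]mulrC.
  have := ler_wpM2l (mulr_ge0 (ltW hCD) G0) hS'; lra.
split => //.
- apply/seteqP; split => [p /(cvg_cluster u_cvg) hp|_ ->].
    by rewrite (norm_hausdorff hp).
  by move=> A B uA /u_cvg uB; exact: filter_ex (filterI uA uB).
- move=> half; rewrite half in r_decay dist.
  pose s n := r n `^ 2^-1.
  have s_succ n : (N <= n)%N -> s n.+1 <= expR c * s n.
    move=> Nn; have r1 := r_ge0 _ (leqW Nn); have r0 := r_ge0 _ Nn.
    (* For a nonpositive argument [ln] takes the default value 0, so [expR c = 1] and monotonicity
       of [r] is enough. *)
    have [b0|b0] := leP (1 - CD * CS / (2 * CL ^+ 2)) 0.
      rewrite /c ln0// expR0 mul1r.
      by apply: ge0_ler_powR; rewrite ?nnegrE ?invr_ge0// r_mono.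
    rewrite /c lnK ?posrE// /s !powR12_sqrt//.
    rewrite -[X in X * _]ger0_norm ?(ltW b0)// -sqrtr_sqr -sqrtrM ?sqr_ge0//.
    rewrite ler_wsqrtr// (le_trans (r_decay _ Nn))//.
    rewrite divff ?pnatr_eq0// subrr addr0 powRr1//.
    have -> : CD * CS / (2 * CL ^+ 2) = CD * CS / CL ^+ 2 / 2.
      by rewrite invfM; ring.
    rewrite -subr_ge0; set q := CD * CS / CL ^+ 2.
    have -> : (1 - q / 2) ^+ 2 * r n - (r n - q * r n) = (q / 2) ^+ 2 * r n.
      by field.
    by rewrite mulr_ge0 ?sqr_ge0.
  have s_geo k : s (N + k)%N <= expR (c * k%:R) * s N.
    elim: k => [|k IH]; first by rewrite mulr0 expR0 mul1r addn0.
    rewrite addnS (le_trans (s_succ _ _)) ?leq_addr//.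
    by rewrite -natr1 mulrDr mulr1 addrC expRD -mulrA ler_pM2l ?expR_gt0.
  have sN0 : 0 <= s N by exact: powR_ge0.
  (* The exponential undoes the shift by [N]; the summand 1 keeps the constant positive when
     [s N = 0]. *)
  exists ((C * s N + 1) * expR (- (c * N%:R))).
    by rewrite mulr_gt0 ?expR_gt0// ltr_wpDl// mulr_ge0// ltW.
  exists N => // n /= Nn; apply: (le_trans (dist n Nn)).
  have := s_geo (n - N)%N; rewrite subnKC// => sn.
  rewrite -mulrA -expRD [- _ + _]addrC -mulrBr -natrB//.
  apply: (@le_trans _ _ (C * (expR (c * (n - N)%:R) * s N))).
    by rewrite ler_pM2l.
  by rewrite mulrCA mulrC ler_pM2r ?expR_gt0// lerDl.
- move=> lt_half; set p := 1 - 2 * theta; have p0 : 0 < p by rewrite /p; lra.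
  have a0 : 0 < CD * CS / CL ^+ 2 by rewrite divr_gt0 ?mulr_gt0 ?exprn_gt0.
  have [K K0 [N1 _ hK]] := powR_recursion_decay p0 a0 r_ge0 r_decay.
  exists (C * K `^ (theta / p)); first by rewrite mulr_gt0 ?powR_gt0.
  exists (maxn N N1) => // n; rewrite /= geq_max => /andP[Nn N1n].
  apply: (le_trans (dist n Nn)); rewrite -mulrA ler_pM2l//.
  have -> : r n `^ theta = (r n `^ p) `^ (theta / p).
    by rewrite -powRrM mulrCA divff ?mulr1 ?gt_eqF.
  rewrite powRN; have -> : (n%:R `^ (theta / p))^-1 = n%:R^-1 `^ (theta / p) :> R.
    by rewrite -[n%:R^-1]powR_inv1// -powRrM mulN1r powRN.
  rewrite -powRM ?invr_ge0 ?(ltW K0)//.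
  apply: ge0_ler_powR; rewrite ?nnegrE ?powR_ge0//.
  - by rewrite divr_ge0// ltW.
  - by rewrite divr_ge0// ltW.
  - exact: hK.
Unshelve. all: by end_near. Qed.
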